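(* Let $\beta,\delta,\mu\in\mathbb{R}$ with $0<\delta$, $0<\mu<1$ and $1+\mu<\beta$. Let $n$ be a positive integer, let $A$ be the set of all prime numbers $p$ with $p\le n^\mu$, let $P$ be a non-zero polynomial of $\mathbb{Z}[T]$ of degree at most $n$ and height at most $\exp(n^\beta)$ having no root which is $0$ or a root of unity, and let $Q\in\mathbb{Z}[T]$ be a greatest common divisor (in $\mathbb{Z}[T]$) of the polynomials $P(T^a)$ with $a\in A$. If $n$ is sufficiently large as a function of $\beta$, $\delta$ and $\mu$ only, then $\deg(Q)\le n^{1-\mu+\delta}$ and $H(Q)\le \exp(n^{\beta-2\mu+\delta})$.
   Context: For a non-zero polynomial $F\in\mathbb{Z}[T]$, its height $H(F)$ is the maximum of the absolute values of its coefficients divided by the greatest common divisor of its coefficients. *)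

(* Defs.v *)
From HB Require Import structures.
From mathcomp Require Import all_boot all_order all_algebra.
From mathcomp Require Import all_classical all_reals all_analysis.
From mathcomp Require Import complex.

Set Implicit Arguments.
Unset Strict Implicit.
Unset Printing Implicit Defensive.

Import Order.TTheory GRing.Theory Num.Theory.

Local Open Scope classical_set_scope.
Local Open Scope ring_scope.

(* Meaningful for F != 0 only; for F = 0 the value is 0 / 0 = 0. *)
Definition height (R : realType) (F : {poly int}) : R :=
  (\max_(i < size F) absz (F`_i)%R)%N%:R
  / (\big[gcdn/0%N]_(i < size F) absz (F`_i)%R)%:R.

(* Divisibility in the ring Z[T]. The library's %| on {poly int} is
   pseudo-divisibility, i.e. divisibility in Q[T]. *)
Definition Zdvdp (D F : {poly int}) : Prop := exists G : {poly int}, F = D * G.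

Definition is_Zgcdp (S : set {poly int}) (Q : {poly int}) : Prop :=
  (forall F, S F -> Zdvdp Q F) /\
  (forall D, (forall F, S F -> Zdvdp D F) -> Zdvdp D Q).

Definition is_root_of_unity (K : nzRingType) (z : K) : Prop :=
  exists2 k : nat, (0 < k)%N & z ^+ k = 1.

Definition primes_le (R : realType) (x : R) : set nat :=
  [set p : nat | prime p /\ p%:R <= x].

(* Main.v *)
Require Import Defs.
From HB Require Import structures.
From mathcomp Require Import all_boot all_order all_algebra.
From mathcomp Require Import all_classical all_reals all_analysis.
From mathcomp Require Import complex.
From mathcomp Require Import closed_field ring lra zify.

Set Implicit Arguments.
Unset Strict Implicit.
Unset Printing Implicit Defensive.

Import Order.TTheory GRing.Theory Num.Theory.

Local Open Scope classical_set_scope.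
Local Open Scope ring_scope.

(* If x is a root of Q then x ^ a is a root of P, of at least the same
   multiplicity, for every prime a <= n ^ mu. The edges (x, a) |-> x ^ a can be
   thinned out so that each x loses, and each root of P receives, at most
   m = O(log n) of them: in a family of edges where every vertex has degree
   above m there are at least 2 ^ m sources, because for a prime a the sources
   split into classes modulo the relation u ^ s = v ^ t with s, t prime to a,
   and two colliding edges (one of them with label a) start in different
   classes. Hence deg Q times the number of primes is at most m deg P.
   Weighting each root z by its absolute logarithmic height h z, which satisfies
   h (z ^ a) = a h z and sums up over the roots of a primitive polynomial to its
   logarithmic Mahler measure, gives in the same way that log M(Q) is at most
   about n ^ (- 2 mu) log M(P). The Mahler measure is comparable to the height
   up to factors negligible because beta > 1 + mu, and Chebyshev's lower bound
   supplies enough primes of size close to n ^ mu. *)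

(** * Collisions between powers of non-torsion elements *)

Section Thinning.
Variable F : fieldType.
Implicit Types (E K : seq (F * nat)) (x y u v : F) (a b m : nat).

Definition nontorsion x := x != 0 /\ forall k, (0 < k)%N -> x ^+ k != 1.

Lemma nontorsion_expI x i j : nontorsion x -> x ^+ i = x ^+ j -> i = j.
Proof.
move=> [x0 xt]; wlog ij : i j / (i <= j)%N => [hw e|].
  by case/orP: (leq_total i j) => h; [exact: hw|apply/esym; exact: hw].
move=> e; apply/eqP; rewrite eqn_leq ij /= leqNgt; apply/negP => lt.
have /xt : (0 < j - i)%N by rewrite subn_gt0.
by rewrite expfB // e divff ?eqxx // expf_neq0.
Qed.

(** For a prime a, u and v agree up to an exponent that is a unit of the integers localised at a.
    Since [coprime a 0] then fails, s and t are positive. *)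
Definition commensurable a u v :=
  exists s t, [/\ coprime a s, coprime a t & u ^+ s = v ^+ t].

Lemma commensurable_refl a u : commensurable a u u.
Proof. by exists 1%N, 1%N; split; rewrite ?coprimen1. Qed.

Lemma commensurable_sym a u v : commensurable a u v -> commensurable a v u.
Proof. by move=> [s [t [as_ at_ e]]]; exists t, s. Qed.

Lemma commensurable_trans a u v w :
  commensurable a u v -> commensurable a v w -> commensurable a u w.
Proof.
move=> [s [t [as_ at_ e]]] [s' [t' [as' at' e']]].
exists (s * s')%N, (t' * t)%N; rewrite !coprimeMr as_ at_ as' at'; split=> //.
by rewrite exprM e -exprM mulnC exprM e' -exprM.
Qed.

(** Combining the two relations gives x^(at) = x^(sb), hence at = sb as x is not torsion. So a
    divides b, whence a = b and s = t, and Bezout for the coprime exponents a and s turns x^a = y^a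
    and x^s = y^s into x = y. *)
Lemma collision_incommensurable a b x y : prime a -> prime b -> nontorsion x ->
  x ^+ a = y ^+ b -> commensurable a x y -> (x, a) = (y, b).
Proof.
move=> pa pb nx e [s [t [as_ at_ e']]].
have /(nontorsion_expI nx) est : x ^+ (a * t) = x ^+ (s * b).
  by rewrite !exprM e e' -!exprM mulnC.
have ab : a = b.
  apply/eqP; rewrite -dvdn_prime2 //.
  by rewrite -(Gauss_dvdr b as_) -est dvdn_mulr.
subst b; congr pair; move: est; rewrite mulnC => /eqP.
rewrite eqn_pmul2r ?prime_gt0 // => /eqP est; subst t.
have x0 : x != 0 by case: nx.
have [y0|y0] := eqVneq y 0.
  move: e => /eqP; rewrite y0 expr0n gtn_eqF ?prime_gt0 // expf_eq0 (negPf x0).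
  by rewrite andbF.
have /eqP := as_; case: (egcdnP s (prime_gt0 pa)) => k l ekl _ g1.
have ek (z : F) : z ^+ (k * a) = z ^+ (l * s) * z.
  by rewrite ekl g1 exprD expr1.
have := ek x; rewrite mulnC exprM e -exprM mulnC ek.
rewrite (mulnC l) !(exprM _ s l) e'.
by move/mulfI => -> //; rewrite !expf_neq0.
Qed.

(** An edge (x, a) runs from x to x^a. Distinct labels are counted rather than edges, so that
    deleting all edges with one label lowers the count by at most one. *)
Definition labels_into E (g : F) := undup [seq e.2 | e <- E & e.1 ^+ e.2 == g].

Definition sources E := undup [seq e.1 | e <- E].

Lemma mem_sources E e : e \in E -> e.1 \in sources E.
Proof. by move=> eE; rewrite mem_undup map_f. Qed.

Lemma labels_intoP E g a :
  reflect (exists2 x, (x, a) \in E & x ^+ a = g) (a \in labels_into E g).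
Proof.
rewrite mem_undup; apply: (iffP mapP) => [[[x b]]|[x xE xg]].
  by rewrite mem_filter /= => /andP[/eqP xg xE] ->; exists x.
by exists (x, a) => //; rewrite mem_filter /= xg eqxx.
Qed.

(* Two colliding edges with labels a and b have a-incommensurable sources, so
   the sources split into at least two classes; deleting label a lowers each
   degree by at most one and respects the classes. *)
Lemma expansion m E : uniq E -> E != [::] ->
  (forall e, e \in E -> prime e.2 /\ nontorsion e.1) ->
  (forall e, e \in E -> (m < count (fun f => f.1 == e.1) E)%N) ->
  (forall e, e \in E ->
     (exists2 y, y != e.1 & (y, e.2) \in E /\ y ^+ e.2 = e.1 ^+ e.2) \/
     (m < size (labels_into E (e.1 ^+ e.2)))%N) ->
  (2 ^ m <= size (sources E))%N.
Proof.
elim: m E => [|m IH] E uE E0 hE dE cE.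
  case: E E0 {uE hE dE cE} => // e E _.
  by have := mem_sources (mem_head e E); case: (sources _).
have [[x a] xaE] : exists e, e \in E by case: E E0 {uE hE dE cE} => // e E _; exists e; rewrite mem_head.
have [/= pa nx] := hE _ xaE.
(* A second edge into x^a: another source with label a, or another label, as at least two labels
   arrive there. *)
have [[y b] ybE [ne exy]] : exists2 e, e \in E & e != (x, a) /\ x ^+ a = e.1 ^+ e.2.
  case: (cE _ xaE) => /= [[y yx [yE yx']]|h].
    by exists (y, a) => //; rewrite xpair_eqE (negPf yx); split.
  have [b bl ba] : exists2 b, b \in labels_into E (x ^+ a) & b != a.
    apply/hasP; rewrite has_predC; apply/negP => /all_pred1P el.
    have ul : uniq (labels_into E (x ^+ a)) := undup_uniq _.
    by move: ul h; rewrite el size_nseq; case: size => [|[]] //= k; rewrite inE eqxx.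
  have /labels_intoP[y yE yx] := bl.
  by exists (y, b) => //; rewrite xpair_eqE (negPf ba) andbF; split.
have [/= pb ny] := hE _ ybE.
pose part u := [seq e <- E | (e.2 != a) && `[< commensurable a e.1 u >]].
have partP u e : reflect [/\ e \in E, e.2 != a & commensurable a e.1 u]
    (e \in part u).
  rewrite mem_filter; apply: (iffP andP) => [[/andP[? /asboolP ?] ?]|[? ? ?]].
    by split.
  by split=> //; apply/andP; split=> //; apply/asboolP.
have part_ge u l : (u, l) \in E -> (2 ^ m <= size (sources (part u)))%N.
  move=> ulE.
  have deg e : e \in E -> commensurable a e.1 u ->
      (m < count (fun f => f.1 == e.1) (part u))%N.
    move=> eE eu; rewrite -ltnS; apply: leq_trans (dE _ eE) _.
    rewrite count_filter -addn1.
    (* Only the edge [(e.1, a)] can be lost at [e.1], and it occurs at most once in the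
       duplicate-free E. *)
    have -> : 1%N = (count (pred1 (e.1, a)) E + (1 - count (pred1 (e.1, a)) E))%N.
      by rewrite subnKC // count_uniq_mem // leq_b1.
    rewrite addnA; apply: leq_trans (leq_addr _ _).
    rewrite -count_predUI; apply: leq_trans (leq_addr _ _).
    apply: sub_count => f /= /eqP fe; rewrite fe eqxx /=.
    have -> : `[< commensurable a e.1 u >] by apply/asboolP.
    by case: f fe => f1 f2 /= ->; rewrite andbT xpair_eqE eqxx orNb.
  apply: IH.
  - exact: filter_uniq.
  - have := deg _ ulE (commensurable_refl _ _).
    by case: (part u).
  - by move=> e /partP[/hE].
  - by move=> e /partP[eE _ eu]; exact: deg.
  move=> [v c] /partP[/= vE ca vu]; have [/= pc nv] := hE _ vE.
  have cop l' : prime l' -> l' != a -> coprime a l'.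
    by move=> pl la; rewrite prime_coprime // dvdn_prime2 // eq_sym.
  (* Edges into v^c with label other than a start in the class of v, because both labels are prime
     to a. So collisions survive and only the label a can disappear. *)
  case: (cE _ vE) => /= [[w wv [wE wvc]]|h]; [left|right].
    exists w => //; split=> //; apply/partP; split=> //=.
    by apply: commensurable_trans vu; exists c, c; rewrite cop.
  rewrite -ltnS; apply: leq_trans h _.
  apply: (@uniq_leq_size _ _ (a :: labels_into (part u) (v ^+ c))).
    exact: undup_uniq.
  move=> b' /labels_intoP[w wE wv]; rewrite inE.
  have [//|ba] := eqVneq b' a; apply/labels_intoP; exists w => //.
  have [/= pb' _] := hE _ wE.
  apply/partP; split=> //=; apply: commensurable_trans vu.
  by exists b', c; rewrite !cop.
have := leq_add (part_ge _ _ xaE) (part_ge _ _ ybE).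
rewrite addnn -mul2n -expnS -size_cat => h; apply: leq_trans h _.
apply: uniq_leq_size.
  rewrite cat_uniq !undup_uniq andbT /=; apply/hasPn => z.
  rewrite !mem_undup => /mapP[e /partP[_ _ ey] ->].
  apply/negP => /mapP[f /partP[_ _ fx] ef].
  move: ne; rewrite (collision_incommensurable pa pb nx exy) ?eqxx //.
  apply: commensurable_trans (commensurable_sym fx) _.
  by rewrite -ef.
by move=> z; rewrite mem_cat !mem_undup => /orP[] /mapP[e /partP[eE _ _] ->];
  exact: map_f.
Qed.

(** Induction on the size of E. If some source has at most m edges, drop them all. Otherwise, if an
    edge is alone with its label at a target receiving at most m labels, move it to K. If neither is
    possible, [expansion] contradicts the bound on the sources. Injectivity for each label is
    carried along so that edges of K into a target can be counted by labels. *)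
Lemma thinning m E : uniq E -> (size (sources E) < 2 ^ m)%N ->
  (forall e, e \in E -> prime e.2 /\ nontorsion e.1) ->
  exists K, [/\ uniq K, {subset K <= E},
    forall x, (count (fun e => e.1 == x) E <=
                 m + count (fun e => e.1 == x) K)%N,
    forall g, (count (fun e => e.1 ^+ e.2 == g) K <= m)%N &
    forall x y a, (x, a) \in K -> (y, a) \in K -> x ^+ a = y ^+ a -> x = y].
Proof.
have [k] := ubnP (size E); elim: k E => // k IH E; rewrite ltnS => Ek uE XE hE.
have smaller E' : (size E' < size E)%N -> uniq E' -> {subset E' <= E} ->
    exists K, [/\ uniq K, {subset K <= E'},
      forall x, (count (fun e => e.1 == x) E' <=
                 m + count (fun e => e.1 == x) K)%N,
      forall g, (count (fun e => e.1 ^+ e.2 == g) K <= m)%N &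
      forall x y a, (x, a) \in K -> (y, a) \in K -> x ^+ a = y ^+ a -> x = y].
  move=> sE' uE' E'E; apply: IH => //; first exact: leq_trans sE' Ek.
    apply: leq_ltn_trans XE; apply: uniq_leq_size; first exact: undup_uniq.
    by move=> z; rewrite !mem_undup => /mapP[e /E'E eE ->]; exact: map_f.
  by move=> e /E'E/hE.
have [E0|E0] := eqVneq E [::]; first by exists [::]; rewrite E0; split.
have [[e eE dm]|dE] := pselect (exists2 e, e \in E &
    (count (fun f => f.1 == e.1) E <= m)%N).
  pose E' := [seq f <- E | f.1 != e.1].
  have sE' : (size E' < size E)%N.
    rewrite size_filter ltn_neqAle count_size andbT -all_count.
    by apply/negP => /allP/(_ _ eE); rewrite eqxx.
  have [K [uK KE dK gK iK]] := smaller E' sE' (filter_uniq _ uE)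
    (mem_subseq (filter_subseq _ _)).
  exists K; split=> // [f /KE|x]; first by rewrite mem_filter => /andP[].
  have [->|xe] := eqVneq x e.1; first exact: leq_trans dm (leq_addr _ _).
  apply: leq_trans (dK x); rewrite count_filter; apply: sub_count => f /= /eqP fx.
  by rewrite fx eqxx xe.
have [[e eE [sole le]]|cE] := pselect (exists2 e, e \in E &
    (forall y, (y, e.2) \in E -> y ^+ e.2 = e.1 ^+ e.2 -> y = e.1) /\
    (size (labels_into E (e.1 ^+ e.2)) <= m)%N); last first.
  move: XE; rewrite ltnNge => /negP[]; apply: expansion => // e eE.
    by rewrite ltnNge; apply/negP => h; apply: dE; exists e.
  have [|nl] := ltnP m (size (labels_into E (e.1 ^+ e.2))); first by right.
  left; apply: contrapT => h; apply: cE; exists e => //; split=> // y yE ye.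
  by apply: contrapT => /eqP yne; apply: h; exists y.
have [K [uK KE dK gK iK]] := smaller (rem e E)
  ltac:(by rewrite size_rem // prednK //; case: (E) eE) (rem_uniq _ uE) (@mem_rem _ e E).
have KE' : {subset e :: K <= E}.
  by move=> f; rewrite inE => /predU1P[->//|/KE/mem_rem].
have eK : e \notin K.
  by apply/negP => /KE; rewrite mem_rem_uniq // inE eqxx.
have iK' x y a : (x, a) \in e :: K -> (y, a) \in e :: K -> x ^+ a = y ^+ a -> x = y.
  case: e sole {le dK eE smaller KE eK} KE' => e1 e2 /= sole KE'.
  rewrite !inE !xpair_eqE => /orP[/andP[/eqP-> /eqP->]|xK] /orP[/andP[/eqP-> /eqP ea]|yK] xy //.
  - by apply/esym/sole => //; apply: KE'; rewrite inE yK orbT.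
  - by rewrite ea in xK xy; apply: sole => //; apply: KE'; rewrite inE xK orbT.
  - exact: iK xK yK xy.
exists (e :: K); split=> //.
- by rewrite /= eK.
- move=> x; have /permP-> := perm_to_rem eE; rewrite /= addnCA leq_add2l; exact: dK.
(* At the target of e, the edges of [e :: K] have distinct labels, all among the at most m labels of
   E arriving there. *)
move=> g; have [->|ge] := eqVneq g (e.1 ^+ e.2); last first.
  by rewrite /= eq_sym (negPf ge); exact: gK.
apply: leq_trans le.
rewrite -size_filter -(size_map snd); apply: uniq_leq_size.
  rewrite map_inj_in_uniq; first by apply: filter_uniq; rewrite /= eK.
  move=> [x a] [y b]; rewrite !mem_filter /= => /andP[/eqP xg xK] /andP[/eqP yg yK] ab.
  by rewrite -ab in yK yg *; rewrite (iK' x y a) // xg yg.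
move=> a /mapP[[x b]]; rewrite mem_filter /= => /andP[/eqP xg /KE' xE] ->.
by apply/labels_intoP; exists x.
Qed.

Lemma sum_fibres (R : pzSemiRingType) (I J : eqType) (g : I -> J) (r : seq I)
    (s : seq J) (us : uniq s) (f : J -> R) : {in r, forall i, g i \in s} ->
  \sum_(i <- r) f (g i) = \sum_(j <- s) (count (fun i => g i == j) r)%:R * f j.
Proof.
elim: r => [_|i r IH h]; first by rewrite big_nil big1 // => j _; rewrite mul0r.
rewrite big_cons IH => [|k kr]; last by apply: h; rewrite inE kr orbT.
under [RHS]eq_bigr => j _ do rewrite /= natrD mulrDl.
rewrite big_split /=; congr (_ + _).
rewrite (bigD1_seq (g i)) ?h ?mem_head //= eqxx mul1r big1 ?addr0 // => j ji.
by rewrite eq_sym (negPf ji) mul0r.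
Qed.

(** Double counting over the thinned edges, weighted by w and by multiplicities: each x keeps at
    least [size B - m] edges, each edge multiplies the weight by at least T, and each target
    receives at most m edges. *)
Lemma weighted_thinning (R : numDomainType) m (T : R) (w : F -> R)
    (rq rp : seq F) (B : seq nat) :
  uniq B -> all prime B -> (size (undup rq) < 2 ^ m)%N ->
  {in rq, forall x, nontorsion x} -> (forall x, 0 <= w x) -> 0 <= T ->
  {in rq & B, forall x a, (count_mem x rq <= count_mem (x ^+ a) rp)%N} ->
  {in rq & B, forall x a, T * w x <= w (x ^+ a)} ->
  (size B - m)%:R * T * (\sum_(x <- rq) w x) <= m%:R * \sum_(x <- rp) w x.
Proof.
move=> uB pB rm nt w0 T0 cnt wT.
have mult (r : seq F) : \sum_(x <- r) w x = \sum_(x <- undup r) w x *+ count_mem x r.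
  rewrite -(big_undup_iterop_count _ _ xpredT).
  by apply: eq_bigr => x _; case: (count_mem x r) => // k; rewrite iteropS; elim: k => //= k ->; rewrite [RHS]mulrS.
pose E := [seq (x, a) | x <- undup rq, a <- B].
have EP x a : ((x, a) \in E) = (x \in rq) && (a \in B).
  apply/allpairsP/andP => [[[y b]] /= [yr bB [-> ->]]|[xr aB]].
    by rewrite mem_undup in yr.
  by exists (x, a); rewrite /= mem_undup.
have uE : uniq E.
  by apply: allpairs_uniq => //; [exact: undup_uniq|move=> [? ?] [? ?]].
have [|e|K [_ KE dK gK _]] := @thinning m E uE.
- apply: leq_ltn_trans rm; apply: uniq_leq_size; first exact: undup_uniq.
  move=> x; rewrite !mem_undup => /mapP[[y a]]; rewrite EP => /andP[yr _] -> /=.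
  by [].
- by case: e => x a; rewrite EP => /andP[xr aB]; split; [exact: (allP pB)|exact: nt].
have KP e : e \in K -> e.1 \in rq /\ e.2 \in B.
  by case: e => x a /KE; rewrite EP => /andP.
rewrite (mult rq) (mult rp) !mulr_sumr.
apply: (@le_trans _ _ (\sum_(e <- K) T * (w e.1 *+ count_mem e.1 rq))).
  rewrite (sum_fibres (undup_uniq rq) (fun x => T * (w x *+ count_mem x rq))); last first.
    by move=> e /KP[]; rewrite mem_undup.
  rewrite [leLHS]big_seq_cond [leRHS]big_seq_cond; apply: ler_sum => x.
  rewrite andbT mem_undup => xr; rewrite -mulrA ler_wpM2r ?mulr_ge0 ?mulrn_wge0 //.
  rewrite ler_nat leq_subLR; apply: leq_trans (dK x).
  rewrite -size_filter -[leqLHS](size_map (pair x)); apply: uniq_leq_size.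
    by rewrite map_inj_uniq // => ? ? [].
  by move=> e /mapP[a aB ->]; rewrite mem_filter eqxx EP xr aB.
apply: (@le_trans _ _ (\sum_(e <- K) w (e.1 ^+ e.2) *+ count_mem (e.1 ^+ e.2) rp)).
  rewrite [leLHS]big_seq_cond [leRHS]big_seq_cond; apply: ler_sum => e.
  rewrite andbT => /KP[er eB]; rewrite mulrnAr.
  apply: le_trans (ler_wMn2r _ (wT _ _ er eB)) _.
  by apply: ler_wpMn2l => //; exact: cnt.
rewrite (sum_fibres (g := fun e => e.1 ^+ e.2) (undup_uniq rp) (fun x => w x *+ count_mem x rp)).
  by apply: ler_sum => x _; rewrite ler_wpM2r ?mulrn_wge0 // ler_nat.
move=> e /KP[er eB]; rewrite mem_undup -has_pred1 has_count.
by apply: leq_trans (cnt _ _ er eB); rewrite -has_count has_pred1.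
Qed.
End Thinning.

(** * Chebyshev's lower bound *)

Section Chebyshev.
Local Open Scope nat_scope.

Definition primes_upto N := [seq p <- iota 0 N.+1 | prime p].

Lemma mem_primes_upto N p : (p \in primes_upto N) = prime p && (p <= N).
Proof. by rewrite mem_filter mem_iota. Qed.

Lemma expn2_le_central_bin k : 2 ^ k <= 'C(k.*2, k).
Proof.
elim: k => // k IH; rewrite doubleS binS expnS.
have e : 'C(k.*2.+1, k.+1) = 'C(k.*2.+1, k).
  by rewrite -bin_sub -?addnn; [congr 'C(_, _); lia|lia].
by rewrite e addnn -mul2n leq_mul2l /= (leq_trans IH) // leq_bin2l.
Qed.

Lemma divn_double_le k q : 0 < q -> k.*2 %/ q <= (k %/ q).*2.+1.
Proof.
move=> q0; rewrite -ltnS ltn_divLR // -!mul2n.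
by have := ltn_ceil k q0; nia.
Qed.

(* Legendre: the p-adic valuation is a sum of terms 0 or 1 over p ^ i <= 2k. *)
Lemma pfactor_central_bin_le k p : 0 < k -> prime p ->
  p ^ logn p 'C(k.*2, k) <= k.*2.
Proof.
move=> k0 pp.
have := bin_fact (leq_addr k k); rewrite addnK addnn => /(congr1 (logn p)).
rewrite !lognM ?muln_gt0 ?fact_gt0 ?bin_gt0 //; last by lia.
rewrite !logn_fact // => e.
suff : logn p 'C(k.*2, k) <= trunc_log p k.*2.
  move=> h; apply: leq_trans (trunc_logP (prime_gt1 pp) _); last by lia.
  by rewrite leq_exp2l // prime_gt1.
(* Legendre's sum for k! is extended by zero terms to the range used for (2k)!. *)
have ext : \sum_(1 <= i < k.+1) k %/ p ^ i = \sum_(1 <= i < k.*2.+1) k %/ p ^ i.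
  have z : \sum_(k.+1 <= i < k.*2.+1) k %/ p ^ i = 0.
    rewrite big_nat_cond big1 // => i /andP[/andP[ki _] _].
    by rewrite divn_small // (leq_trans _ (ltn_expl i (prime_gt1 pp))) // ltnW.
  by rewrite [RHS](@big_cat_nat _ _ _ k.+1) //= ?z ?addn0 //; lia.
have : \sum_(1 <= i < k.*2.+1) k.*2 %/ p ^ i <=
    \sum_(1 <= i < k.*2.+1) (2 * (k %/ p ^ i) + (i <= trunc_log p k.*2)).
  rewrite big_nat_cond [leqRHS]big_nat_cond; apply: leq_sum => i _.
  case: (leqP i (trunc_log p k.*2)) => [_|h]; first by rewrite /= addn1 mul2n divn_double_le // expn_gt0 prime_gt0.
  rewrite divn_small //; apply: leq_trans (trunc_log_ltn _ (prime_gt1 pp)) _.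
  by rewrite leq_exp2l // prime_gt1.
rewrite big_split /= -big_distrr /= -ext.
have : \sum_(1 <= i < k.*2.+1) (i <= trunc_log p k.*2) <= trunc_log p k.*2.
  have ind j L : \sum_(1 <= i < j.+1) (i <= L) = minn j L.
    elim: j => [|j IH]; first by rewrite big_nil min0n.
    by rewrite big_nat_recr //= IH; lia.
  by rewrite ind geq_minr.
lia.
Qed.


(** With k = N/2 rounded down, 2^k is at most the central binomial coefficient, a product over
    primes up to N of prime powers that are at most 2k, hence at most 2^(1 + log N). *)
Lemma chebyshev N : N./2 <= (trunc_log 2 N).+1 * size (primes_upto N).
Proof.
have [->//|k0] := posnP N./2; set k := N./2 in k0 *.
have kN : k.*2 <= N by rewrite /k; lia.
have C0 : 0 < 'C(k.*2, k) by rewrite bin_gt0; lia.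
rewrite -(leq_exp2l _ _ (ltnSn 1)).
apply: leq_trans (expn2_le_central_bin k) _.
rewrite expnM [leqLHS](prod_prime_decomp C0) prime_decompE big_map /=.
apply: (@leq_trans (\prod_(p <- primes 'C(k.*2, k)) 2 ^ (trunc_log 2 N).+1)).
  rewrite big_seq [leqRHS]big_seq; apply: leq_prod => p.
  rewrite mem_primes => /and3P[pp _ _].
  apply: leq_trans (pfactor_central_bin_le k0 pp) _.
  exact: leq_trans kN (ltnW (trunc_log_ltn N (ltnSn 1))).
rewrite big_const_seq iter_muln_1 count_predT leq_exp2l; last by rewrite -{1}(expn0 2) ltn_exp2l.
apply: uniq_leq_size; first exact: primes_uniq.
move=> p pC; have := pC; rewrite mem_primes mem_primes_upto => /and3P[pp _ _].
rewrite pp; apply: leq_trans kN; apply: leq_trans (pfactor_central_bin_le k0 pp).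
by rewrite -[leqLHS]expn1 leq_exp2l ?prime_gt1 // logn_gt0.
Qed.

End Chebyshev.

(** * The polynomial of a-th powers of roots *)

(* Multiplication by X on S[X] seen as a free S[X^a]-module of rank a = b + 1. *)
Lemma ex_power_companion (S : comNzRingType) (b : nat) :
  exists N : 'M[{poly S}]_b.+1, char_poly N = 'X^(b.+1) - 'X%:P.
Proof.
pose p : {poly {poly S}} := 'X^(b.+1) - 'X%:P.
have mp : p \is monic by rewrite monicXnsubC.
have sp : (size p).-1 = b.+1 by rewrite size_XnsubC.
exists (castmx (sp, sp) (companionmx p)).
by rewrite -[RHS](companionmxK mp); case: _ / sp.
Qed.

Lemma det_sub_scalar (S : comNzRingType) (b : nat) (N : 'M[S]_b.+1) (z : S) :
  \det (N - z%:M) = (-1) ^+ b.+1 * (char_poly N).[z].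
Proof.
have -> : N - z%:M = - map_mx (horner_eval z) (char_poly_mx N).
  apply/matrixP => i j; rewrite !mxE /horner_eval !hornerE hornerMn hornerX.
  by rewrite opprB.
by rewrite -scaleN1r detZ det_map_mx.
Qed.

(** Take G = det q(N), where N has characteristic polynomial Y^a - X with a = b + 1. Each root z of
    q contributes det(N - z), which is X - z^a up to sign. G is built over the integers before K is
    chosen, so one G serves every characteristic. *)
Lemma graeffe (b : nat) (q : {poly int}) : exists G : {poly int},
  forall (K : fieldType) (c : K) (s : seq K),
    map_poly intr q = c *: \prod_(z <- s) ('X - z%:P) ->
  exists e : nat,
    map_poly intr G = ((-1) ^+ e * c ^+ b.+1) *: \prod_(z <- s) ('X - (z ^+ b.+1)%:P).
Proof.
have [N chN] := ex_power_companion int b.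
exists (\det (horner_mx N (map_poly polyC q))) => K c s eq.
pose f : {rmorphism {poly int} -> {poly K}} := map_poly intr.
pose N' := map_mx f N.
have chN' : char_poly N' = 'X^(b.+1) - 'X%:P.
  rewrite -map_char_poly chN rmorphB /= map_polyXn map_polyC /=.
  by rewrite /f /= map_polyX.
have -> : map_poly intr (\det (horner_mx N (map_poly polyC q))) =
    \det (horner_mx N' (map_poly polyC (map_poly intr q))).
  rewrite -[LHS]/(f _) -det_map_mx map_horner_mx -!map_poly_comp; congr (\det (horner_mx _ _)).
  by apply: eq_map_poly => i /=; rewrite /f /= map_polyC.
rewrite eq.
have -> : map_poly polyC (c *: \prod_(z <- s) ('X - z%:P)) =
   c%:P *: \prod_(z <- s) ('X - z%:P%:P).
  rewrite map_polyZ rmorph_prod; congr (_ *: _); apply: eq_bigr => z _.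
  by rewrite rmorphB /= map_polyX map_polyC.
rewrite linearZ /= detZ.
(* Each root gives the sign (-1)^(b+1) of the determinant and one more from turning z^a - X
   around. *)
exists (size s * b.+2)%N.
have -> : \det (horner_mx N' (\prod_(z <- s) ('X - z%:P%:P))) =
    ((-1) ^+ (size s * b.+2))%:P * \prod_(z <- s) ('X - (z ^+ b.+1)%:P).
  have sgn z : (-1) ^+ b.+1 * ((z ^+ b.+1)%:P - 'X) =
      ((-1) ^+ b.+2)%:P * ('X - (z ^+ b.+1)%:P) :> {poly K}.
    by rewrite (polyC_exp b.+2) polyCN polyC1 [in RHS]exprS mulN1r mulNr -mulrN opprB.
  elim: s {eq} => [|z s IH]; first by rewrite !big_nil rmorph1 det1 mul1r.
  rewrite !big_cons rmorphM /= -[X in \det X]/(_ *m _) det_mulmx IH.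
  rewrite rmorphB /= horner_mx_X horner_mx_C det_sub_scalar chN' hornerD hornerXn hornerN hornerC.
  by rewrite -polyC_exp sgn mulSn exprD (polyCM ((-1) ^+ b.+2)) mulrACA.
by rewrite -polyC_exp -mul_polyC polyCM mulrA [_%:P * _%:P]mulrC.
Qed.

(** The absolute value is taken because [zcontents] carries the sign of the leading coefficient. *)
Definition zprim (p : {poly int}) : bool := `|zcontents p|%N == 1%N.

Lemma map_poly_Fp_eq0 (l : nat) (p : {poly int}) : prime l ->
  (map_poly (intr : int -> 'F_l) p == 0) = (l %| `|zcontents p|)%N.
Proof.
move=> pl; rewrite -[RHS]/(l%:Z %| zcontents p)%Z dvdz_contents.
apply/eqP/polyOverP => [p0 i|h].
  have /polyP/(_ i) := p0; rewrite coef_map coef0 /= => /eqP.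
  by rewrite -(dvdz_pcharf (pchar_Fp pl)).
apply/polyP => i; rewrite coef_map coef0 /=; apply/eqP.
by rewrite -(dvdz_pcharf (pchar_Fp pl)); exact: h.
Qed.

(** If a prime l divided the content of G, then G would vanish over an algebraic closure of the
    field with l elements. There, however, it is a non-zero multiple of a monic product, since q
    does not vanish modulo l. *)
Lemma graeffe_zprim (b : nat) (q : {poly int}) : zprim q -> exists G : {poly int},
  zprim G /\
  forall (K : fieldType) (c : K) (s : seq K),
    map_poly intr q = c *: \prod_(z <- s) ('X - z%:P) ->
  exists e : nat,
    map_poly intr G = ((-1) ^+ e * c ^+ b.+1) *: \prod_(z <- s) ('X - (z ^+ b.+1)%:P).
Proof.
move=> pq; have [G hG] := graeffe b q; exists G; split=> //.
apply: contraT => nG.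
have [l pl lG] : exists2 l, prime l & (l %| `|zcontents G|)%N.
  (* Content 0, that is G = 0, is divisible by any prime. *)
  have [->|c0] := eqVneq `|zcontents G|%N 0%N; first by exists 2%N.
  exists (pdiv `|zcontents G|); last exact: pdiv_dvd.
  by apply: pdiv_prime; move: c0 nG; rewrite /zprim; case: absz => [|[]].
have q0 : map_poly (intr : int -> 'F_l) q != 0.
  by rewrite map_poly_Fp_eq0 // (eqP pq) dvdn1 gtn_eqF ?prime_gt1.
have G0 : map_poly (intr : int -> 'F_l) G = 0.
  by apply/eqP; rewrite map_poly_Fp_eq0.
have [K [f _]] := countable_algebraic_closure 'F_l.
have fint p : map_poly (intr : int -> K) p = map_poly f (map_poly (intr : int -> 'F_l) p).
  by rewrite -map_poly_comp; apply: eq_map_poly => i /=; rewrite rmorph_int.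
have [s es] := closed_field_poly_normal (map_poly (intr : int -> K) q).
have [e] := hG _ _ _ es; rewrite (fint G) G0 rmorph0 => /esym/eqP.
rewrite scaler_eq0 mulf_eq0 signr_eq0 /= expf_eq0 lead_coef_eq0 fint map_poly_eq0.
rewrite (negPf q0) andbF /= => /eqP p0.
by move: (monic_neq0 (monic_prod_XsubC s xpredT (fun z => z ^+ b.+1))); rewrite p0 eqxx.
Qed.

(** * Mahler measure and heights of roots *)

Section MahlerMeasure.
Variable R : realType.
Local Notation C := R[i].
Implicit Types (F G P q : {poly int}) (z : C).

Local Notation nrm := (@Normc.normc R).

Lemma nrmE z : `|z| = (nrm z)%:C%C.
Proof. by rewrite normc_def; case: z. Qed.

Lemma nrm_ge0 z : 0 <= nrm z.
Proof. by case: z => a b; exact: sqrtr_ge0. Qed.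

Lemma nrm_int (i : int) : nrm i%:~R = `|i|%N%:R.
Proof.
by apply: complexI; rewrite -nrmE rmorph_nat -intr_norm -abszE.
Qed.

Lemma nrmX z k : nrm (z ^+ k) = nrm z ^+ k.
Proof.
by elim: k => [|k IH]; rewrite ?expr0 ?Normc.normc1 // !exprS Normc.normcM IH.
Qed.

Definition toC F : {poly C} := map_poly intr F.

Lemma toC_eq0 F : (toC F == 0) = (F == 0).
Proof. by rewrite -!size_poly_eq0 size_map_inj_poly //; exact: intr_inj. Qed.

Lemma lead_coef_toC F : lead_coef (toC F) = (lead_coef F)%:~R.
Proof. by rewrite lead_coef_map_inj //; exact: intr_inj. Qed.

Lemma toCM F G : toC (F * G) = toC F * toC G.
Proof. exact: rmorphM. Qed.

(* The complex roots of F, with multiplicity; meaningful for F != 0 only. *)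
Definition rts F : seq C := sval (closed_field_poly_normal (toC F)).

Lemma rtsE F : toC F = (lead_coef F)%:~R *: \prod_(z <- rts F) ('X - z%:P).
Proof. by rewrite -lead_coef_toC; exact: svalP (closed_field_poly_normal (toC F)). Qed.

Lemma mu_scale_prod (K : fieldType) (c x : K) (s : seq K) : c != 0 ->
  mup x (c *: \prod_(z <- s) ('X - z%:P)) = count_mem x s.
Proof.
move=> c0; rewrite -mul_polyC mupMr ?mu_prod_XsubC //.
by rewrite rootC.
Qed.

Lemma count_rts F x : F != 0 -> count_mem x (rts F) = mup x (toC F).
Proof. by move=> F0; rewrite rtsE mu_scale_prod // intr_eq0 lead_coef_eq0. Qed.

Lemma perm_rts F (c : C) s : F != 0 ->
  toC F = c *: \prod_(z <- s) ('X - z%:P) -> perm_eq (rts F) s.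
Proof.
move=> F0 e; apply/allP => x _ /=; rewrite count_rts // e mu_scale_prod //.
by apply: contraNneq F0 => c0; rewrite -toC_eq0 e c0 scale0r.
Qed.

Lemma mem_rts F z : F != 0 -> (z \in rts F) = root (toC F) z.
Proof.
by move=> F0; rewrite rtsE rootZ ?root_prod_XsubC // intr_eq0 lead_coef_eq0.
Qed.

Lemma size_rts F : F != 0 -> size (rts F) = (size F).-1.
Proof.
move=> F0; have <- : size (toC F) = size F by rewrite size_map_inj_poly //; exact: intr_inj.
by rewrite rtsE size_scale ?size_prod_XsubC // intr_eq0 lead_coef_eq0.
Qed.

Lemma perm_rtsM F G : F != 0 -> G != 0 -> perm_eq (rts (F * G)) (rts F ++ rts G).
Proof.
move=> F0 G0; apply: (@perm_rts _ (lead_coef F * lead_coef G)%:~R).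
  by rewrite mulf_neq0.
by rewrite toCM !rtsE big_cat /= -scalerAl -scalerAr scalerA intrM.
Qed.

Definition logmax1 z : R := ln (Num.max 1 (nrm z)).

Lemma logmax1_ge0 z : 0 <= logmax1 z.
Proof. by rewrite ln_ge0 // le_max lexx. Qed.

Lemma logmax1X z k : logmax1 (z ^+ k) = k%:R * logmax1 z.
Proof.
rewrite /logmax1 nrmX mulr_natl -lnXn ?lt_max ?ltr01 //; congr ln.
have [h|h] := lerP 1 (nrm z).
  by rewrite max_r // exprn_ege1.
by rewrite max_l ?expr1n // exprn_ile1 ?nrm_ge0 // ltW.
Qed.

(** The logarithmic Mahler measure, in the form given by Jensen's formula. *)
Definition logM F : R := ln (`|lead_coef F|%N%:R) + \sum_(z <- rts F) logmax1 z.

Lemma logM_ge0 F : 0 <= logM F.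
Proof.
apply: addr_ge0; last by apply: sumr_ge0 => z _; exact: logmax1_ge0.
have [->|] := posnP `|lead_coef F|%N; first by rewrite ln0.
by move=> h; rewrite ln_ge0 // ler1n.
Qed.

Lemma logMM F G : F != 0 -> G != 0 -> logM (F * G) = logM F + logM G.
Proof.
move=> F0 G0; rewrite /logM (perm_big _ (perm_rtsM F0 G0)) big_cat /=.
rewrite lead_coefM abszM natrM lnM ?posrE ?ltr0n ?absz_gt0 ?lead_coef_eq0 //.
by rewrite addrACA.
Qed.

Definition minp z q := [/\ q != 0, zprim q, root (toC q) z &
  forall F, F != 0 -> root (toC F) z -> (size q <= size F)%N].

Lemma zprim_neq0 q : zprim q -> q != 0.
Proof. by apply: contraTneq => ->; rewrite /zprim zcontents0. Qed.

Lemma zprimM F G : zprim (F * G) = zprim F && zprim G.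
Proof. by rewrite /zprim zcontentsM abszM muln_eq1. Qed.

Lemma zprimC (c : int) : zprim c%:P = (`|c|%N == 1%N).
Proof. by rewrite /zprim -alg_polyC zcontentsZ zcontents_monic ?monic1 // mulr1. Qed.

Lemma logM_zprimC (c : int) : zprim c%:P -> logM c%:P = 0.
Proof.
move=> pc; have c0 := zprim_neq0 pc.
have := size_rts c0; rewrite size_polyC => sr.
rewrite /logM lead_coefC (eqP (etrans (esym (zprimC c)) pc)) ln1 add0r.
by rewrite (size0nil (s := rts _)) ?big_nil // sr; case: (c != 0).
Qed.

Lemma ex_minp F z : F != 0 -> root (toC F) z -> exists q, minp z q.
Proof.
move=> F0 Fz.
have ex : exists k, `[< exists G, [/\ G != 0, root (toC G) z & size G = k] >].
  by exists (size F); apply/asboolP; exists F.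
case: (ex_minnP ex) => k /asboolP[G [G0 Gz sG]] kmin.
exists (zprimitive G); split.
- by rewrite zprimitive_eq0.
- by rewrite /zprim zcontents_primitive G0.
- move: Gz; rewrite {1}(zpolyEprim G) /toC map_polyZ rootZ //.
  by rewrite intr_eq0 zcontents_eq0.
- rewrite size_zprimitive sG => H H0 Hz; apply: kmin; apply/asboolP.
  by exists H.
Qed.

(** The pseudo-remainder of F by q vanishes at z and is shorter than q, so it is zero; primitivity
    of q makes the quotient integral (Gauss). *)
Lemma dvd_minp z q F : minp z q -> root (toC F) z -> exists G, F = q * G.
Proof.
move=> [q0 pq qz qmin] Fz.
have : q %| F.
  rewrite /dvdp; apply: contraT => r0.
  have : (size (F %% q)%R < size q)%N by rewrite Pdiv.Idomain.ltn_modp.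
  rewrite ltnNge qmin //.
  have /(congr1 (fun p => (toC p).[z])) := Pdiv.Idomain.divp_eq F q.
  rewrite -mul_polyC /toC rmorphD !rmorphM /= hornerD !hornerM.
  rewrite (rootP Fz) (rootP qz) !mulr0 add0r => e.
  by apply/rootP; rewrite -e.
move/dvdpP_int => [r ->].
have cc : zcontents q * zcontents q = 1.
  by move: pq; rewrite /zprim; case: (zcontents q) => [[|[]]|[]].
exists (zcontents q *: r); rewrite -scalerAr scalerAl.
by rewrite {3}(zpolyEprim q) scalerA cc scale1r.
Qed.

(** Irreducibility of q: the minimal polynomial of z' divides q, and by minimality the cofactor is
    too short to vanish at z. *)
Lemma minp_conj z z' q : minp z q -> root (toC q) z' -> minp z' q.
Proof.
move=> mq qz'; have [q0 pq qz qmin] := mq; split=> // F F0 Fz'.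
have [q' mq'] := ex_minp q0 qz'; have [q'0 pq' q'z' q'min] := mq'.
apply: leq_trans (q'min _ F0 Fz').
have [r er] := dvd_minp mq' qz'.
have r0 : r != 0 by apply: contraNneq q0 => r0; rewrite er r0 mulr0.
move: (qz); rewrite er toCM rootM => /orP[|] /qmin; first by rewrite -er; apply.
move=> /(_ r0); rewrite er size_mul //.
have : (1 < size q')%N.
  rewrite -(size_map_inj_poly (@intr_inj C)) //.
  by apply: root_size_gt1 q'z'; rewrite toC_eq0.
by case: (size q') => [|[|k]] // _; rewrite !addSn /= ltnNge leq_addl.
Qed.

(* The absolute logarithmic Weil height of z; junk value 0 if z is transcendental. *)
Definition root_height z : R :=
  if pselect (exists q, minp z q) is left e
  then logM (projT1 (cid e)) / (size (projT1 (cid e))).-1%:R else 0.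

Lemma root_height_ge0 z : 0 <= root_height z.
Proof.
rewrite /root_height; case: pselect => // e; rewrite divr_ge0 //; exact: logM_ge0.
Qed.

Lemma root_heightE z q : minp z q -> root_height z = logM q / (size q).-1%:R.
Proof.
move=> mq; rewrite /root_height; case: pselect => [e|[]]; last by exists q.
case: (cid e) => q' mq' /=.
have [q0 pq qz qmin] := mq; have [q'0 pq' q'z q'min] := mq'.
have [r er] := dvd_minp mq' qz.
have r0 : r != 0 by apply: contraNneq q0 => r0; rewrite er r0 mulr0.
have ss : size q = size q' by apply/eqP; rewrite eqn_leq qmin ?q'min.
have /size_poly1P[c c0 ec] : size r == 1%N.
  move: ss; rewrite er size_mul // => /eqP.
  by rewrite -subn1 -addnBA ?size_poly_gt0 // -{2}[size q']addn0 eqn_add2l subn_eq0 eqn_leq size_poly_gt0 r0 andbT.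
have pr : zprim r by move: pq; rewrite er zprimM => /andP[].
by rewrite -ss er logMM // ec logM_zprimC ?addr0 // -ec.
Qed.

(** Split off the minimal polynomial q of a root: its deg q roots all have height logM(q) / deg q.
    Primitivity is inherited by the cofactor and leaves no constant contribution at the end. *)
Lemma logM_sum F : zprim F -> logM F = \sum_(z <- rts F) root_height z.
Proof.
have [k] := ubnP (size F); elim: k F => // k IH F; rewrite ltnS => Fk pF.
have F0 := zprim_neq0 pF.
case eF : (rts F) (size_rts F0) => [|z s] /= sF.
  have /size1_polyC eC : (size F <= 1)%N by case: (size F) sF => [|[]].
  by rewrite big_nil eC logM_zprimC // -eC.
have Fz : root (toC F) z by rewrite -mem_rts // eF mem_head.
have [q mq] := ex_minp F0 Fz; have [q0 pq qz _] := mq.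
have [G eG] := dvd_minp mq Fz; move: (pF); rewrite eG zprimM => /andP[_ pG].
have G0 := zprim_neq0 pG.
have sq : (1 < size q)%N.
  rewrite -(size_map_inj_poly (@intr_inj C)) //.
  by apply: root_size_gt1 qz; rewrite toC_eq0.
rewrite -eF eG logMM // (perm_big _ (perm_rtsM q0 G0)) big_cat /= -(IH G) //.
  congr (_ + _); rewrite big_seq.
  rewrite (eq_bigr (fun _ => logM q / (size q).-1%:R)); last first.
    by move=> y; rewrite mem_rts // => /(minp_conj mq)/root_heightE.
  rewrite -big_seq big_const_seq count_predT size_rts // iter_addr addr0.
  by rewrite -[RHS]mulr_natr divfK // pnatr_eq0; case: (size q) sq => [|[]].
apply: leq_trans Fk; rewrite eG size_mul //; case: (size q) sq => [|[|j]] //= _.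
by rewrite addSn ltnS leq_addl.
Qed.

(** With a = b + 1 and q the minimal polynomial of z, the primitive G with roots y^a satisfies
    logM(G) = a logM(q). The roots of G all have the height of z^a, so logM(G) is also deg q times
    that height. *)
Lemma root_heightX z b F : F != 0 -> root (toC F) z ->
  root_height (z ^+ b.+1) = b.+1%:R * root_height z.
Proof.
move=> F0 Fz; have [q mq] := ex_minp F0 Fz; have [q0 pq qz _] := mq.
have [G [pG hG]] := graeffe_zprim b pq.
have [e eG] := hG _ _ _ (rtsE q).
have G0 := zprim_neq0 pG.
have := eG; rewrite -(big_map (fun y => y ^+ b.+1) xpredT (fun y => 'X - y%:P)).
move=> /(perm_rts G0) pG'.
have sq : (1 < size q)%N.
  rewrite -(size_map_inj_poly (@intr_inj C)) //.
  by apply: root_size_gt1 qz; rewrite toC_eq0.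
have Gz : root (toC G) (z ^+ b.+1).
  by rewrite -mem_rts // (perm_mem pG'); apply/mapP; exists z; rewrite ?mem_rts.
have [p mp] := ex_minp G0 Gz; have [p0 pp pz _] := mp.
(* If p is the minimal polynomial of z^a, then q divides p(X^a), so y^a is a root of p for every
   conjugate y of z. *)
have hc y : y \in rts q -> root_height (y ^+ b.+1) = root_height (z ^+ b.+1).
  rewrite mem_rts // => qy.
  have [|r er] := @dvd_minp z q (p \Po 'X^(b.+1)) mq.
    by rewrite /toC map_comp_poly map_polyXn /root horner_comp hornerXn.
  have : root (toC (p \Po 'X^(b.+1))) y by rewrite er toCM rootM qy.
  rewrite /toC map_comp_poly map_polyXn /root horner_comp hornerXn => py.
  by rewrite (root_heightE mp) (root_heightE (minp_conj mp py)).
have eL : logM G = b.+1%:R * logM q.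
  rewrite /logM (perm_big _ pG') big_map mulrDr mulr_sumr.
  congr (_ + _); last by apply: eq_bigr => y _; rewrite logmax1X.
  have -> : `|lead_coef G|%N%:R = (`|lead_coef q|%N%:R : R) ^+ b.+1.
    rewrite -2!nrm_int -lead_coef_toC /toC eG lead_coefZ.
    rewrite (monicP (monic_prod_XsubC _ _ _)) mulr1 Normc.normcM !nrmX.
    have -> : nrm (-1) = 1 by rewrite -(rmorphN1 intr) nrm_int.
    by rewrite expr1n mul1r.
  by rewrite lnXn ?mulr_natl // ltr0n absz_gt0 lead_coef_eq0.
have d0 : (size q).-1%:R != 0 :> R by rewrite pnatr_eq0; case: (size q) sq => [|[]].
rewrite (root_heightE mq) mulrA -eL logM_sum // (perm_big _ pG') big_map big_seq.
rewrite (eq_bigr (fun _ => root_height (z ^+ b.+1))) => [|y]; last exact: hc.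
rewrite -big_seq big_const_seq count_predT size_rts // iter_addr addr0.
by rewrite -[X in X / _]mulr_natr mulfK.
Qed.
End MahlerMeasure.

(** * Mahler measure against the size of the coefficients *)

Section NormBounds.
Variable R : realType.
Local Notation C := R[i].
Implicit Types (F G P q : {poly int}) (z c : C).
Local Notation nrm := (@Normc.normc R).

Lemma nrmD (x y : C) : nrm (x + y) <= nrm x + nrm y.
Proof. by rewrite -lecR rmorphD /= -!nrmE ler_normD. Qed.

Lemma nrmN (x : C) : nrm (- x) = nrm x.
Proof. by apply: complexI; rewrite -!nrmE normrN. Qed.

Lemma nrmB (x y : C) : nrm (x - y) <= nrm x + nrm y.
Proof. by apply: le_trans (nrmD _ _) _; rewrite nrmN. Qed.

Lemma coef_XsubCM z (G : {poly C}) i :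
  (('X - z%:P) * G)`_i = (if i == 0%N then 0 else G`_i.-1) - z * G`_i.
Proof. by rewrite mulrBl coefB coefXM coefCM. Qed.

Lemma nrm_coef_prod_le c (r : seq C) i :
  nrm (c *: \prod_(z <- r) ('X - z%:P))`_i <=
  nrm c * 2 ^+ size r * \prod_(z <- r) Num.max 1 (nrm z).
Proof.
elim: r i => [|z r IH] i.
  rewrite !big_nil expr0 !mulr1 coefZ coef1.
  by case: (i == 0%N); rewrite ?mulr1 // mulr0 Normc.normc0 nrm_ge0.
rewrite !big_cons scalerAr coef_XsubCM; apply: le_trans (nrmB _ _) _.
set b := nrm c * 2 ^+ size r * _ in IH.
have b0 : 0 <= b := le_trans (nrm_ge0 _) (IH 0%N).
rewrite (_ : _ * _ = b * Num.max 1 (nrm z) + Num.max 1 (nrm z) * b); last first.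
  by rewrite /b /= exprS; lra.
have m1 : 1 <= Num.max 1 (nrm z) by rewrite le_max lexx.
apply: lerD.
  apply: (@le_trans _ _ b); last by rewrite ler_peMr.
  by case: eqP => _; rewrite ?Normc.normc0.
rewrite Normc.normcM; apply: ler_pM; rewrite ?nrm_ge0 // le_max lexx orbT //.
Qed.

(* From the recurrence f_i = g_(i-1) - z g_i, run downwards if |z| <= 1 and
   upwards otherwise. *)
Lemma nrm_coef_quotient_le z (G : {poly C}) N (S : R) :
  (size G <= N)%N -> (forall i, nrm (('X - z%:P) * G)`_i <= S) ->
  forall i, Num.max 1 (nrm z) * nrm G`_i <= N%:R * S.
Proof.
move=> sG hS i.
have S0 : 0 <= S := le_trans (nrm_ge0 _) (hS 0%N).
have [z1|z1] := lerP 1 (nrm z).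
  have [iN|iN] := leqP N i.
    by rewrite nth_default ?(leq_trans sG) // Normc.normc0 mulr0 mulr_ge0.
  apply: (@le_trans _ _ (i.+1%:R * S)); last by rewrite ler_wpM2r // ler_nat.
  elim: i {iN} => [|i IH].
    by have := hS 0%N; rewrite coef_XsubCM sub0r nrmN Normc.normcM mulr_natl.
  have e : z * G`_i.+1 = G`_i - (('X - z%:P) * G)`_i.+1.
    by rewrite coef_XsubCM /= opprB addrC subrK.
  rewrite -Normc.normcM e -natr1 [leRHS]mulrDl mul1r; apply: le_trans (nrmB _ _) _.
  apply: lerD (hS _); apply: le_trans IH.
  by rewrite ler_peMl ?nrm_ge0.
rewrite mul1r.
suff : forall j k, (N <= k + j)%N -> nrm G`_k <= j%:R * S.
  by move=> /(_ N i); apply; exact: leq_addl.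
elim=> [|j IH] k; first by rewrite addn0 mul0r => Nk; rewrite nth_default ?(leq_trans sG) // Normc.normc0.
rewrite addnS -addSn => /IH h.
have e : G`_k = (('X - z%:P) * G)`_k.+1 + z * G`_k.+1.
  by rewrite coef_XsubCM /= subrK.
rewrite e -natr1 [leRHS]mulrDl mul1r; apply: le_trans (nrmD _ _) _.
rewrite addrC; apply: lerD (hS _); apply: le_trans h.
by rewrite Normc.normcM ler_piMl ?nrm_ge0 // ltW.
Qed.

(** Roots are divided out one at a time, each division costing a factor N by [nrm_coef_quotient_le].
    The resulting N^deg is harmless later, as n log n is small against n^beta. *)
Lemma mahler_le c (r : seq C) N (S : R) : (size r < N)%N ->
  (forall i, nrm (c *: \prod_(z <- r) ('X - z%:P))`_i <= S) ->
  nrm c * \prod_(z <- r) Num.max 1 (nrm z) <= N%:R ^+ size r * S.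
Proof.
elim: r S => [|z r IH] S /= sr hS.
  by have := hS 0%N; rewrite !big_nil expr0 mul1r mulr1 coefZ coef1 mulr1.
have m0 : 0 < Num.max 1 (nrm z) by rewrite lt_max ltr01.
have := IH ((Num.max 1 (nrm z))^-1 * (N%:R * S)) (ltnW sr) _.
rewrite big_cons => h; rewrite mulrCA -ler_pdivlMl //.
apply: le_trans (h _) _; last first.
  by rewrite exprSr le_eqVlt; apply/orP; left; apply/eqP; ring.
move=> i; rewrite ler_pdivlMl //.
apply: nrm_coef_quotient_le => [|j].
  by apply: leq_trans (size_scale_leq _ _) _; rewrite size_prod_XsubC ltnW.
by rewrite -scalerAr; have := hS j; rewrite big_cons.
Qed.

Lemma expR_logM F : F != 0 ->
  expR (logM R F) = nrm (lead_coef F)%:~R * \prod_(z <- rts R F) Num.max 1 (nrm z).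
Proof.
move=> F0; rewrite expRD expR_sum lnK; last first.
  by rewrite posrE ltr0n absz_gt0 lead_coef_eq0.
rewrite nrm_int; congr (_ * _); apply: eq_bigr => z _.
by rewrite lnK // posrE lt_max ltr01.
Qed.

Lemma nrm_coef_toC F i : nrm (toC R F)`_i = `|(F`_i)%R|%N%:R.
Proof. by rewrite coef_map nrm_int. Qed.

Lemma coef_le_mahler F i : F != 0 ->
  `|(F`_i)%R|%N%:R <= 2 ^+ (size F).-1 * expR (logM R F).
Proof.
move=> F0; rewrite expR_logM // -nrm_coef_toC rtsE -(size_rts R F0).
by apply: le_trans (nrm_coef_prod_le _ _ _) _; rewrite mulrA [2 ^+ _ * _]mulrC.
Qed.

Lemma mahler_le_coef F N (S : R) : F != 0 -> (size F <= N)%N ->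
  (forall i, `|(F`_i)%R|%N%:R <= S) -> expR (logM R F) <= N%:R ^+ (size F).-1 * S.
Proof.
move=> F0 sF hS; rewrite expR_logM // -(size_rts R F0).
apply: mahler_le => [|i].
  by rewrite size_rts // prednK // size_poly_gt0.
by rewrite -rtsE nrm_coef_toC.
Qed.

Lemma abs_coef_zprimitive F i :
  `|(F`_i)%R|%N = (`|zcontents F| * `|((zprimitive F)`_i)%R|)%N.
Proof. by rewrite {1}(zpolyEprim F) coefZ abszM. Qed.

Lemma gcd_coef_zcontents F : F != 0 ->
  \big[gcdn/0%N]_(i < size F) absz (F`_i)%R = `|zcontents F|%N.
Proof.
rewrite -lead_coef_eq0 => l0; rewrite /zcontents abszM.
have -> : `|sgz (lead_coef F)|%N = 1%N by rewrite /sgz (negPf l0); case: ifP.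
by rewrite mul1n.
Qed.

Lemma coef_zprimitive_le_height F i : F != 0 ->
  `|((zprimitive F)`_i)%R|%N%:R <= height R F.
Proof.
move=> F0; rewrite /height gcd_coef_zcontents //.
have c0 : (0 < `|zcontents F|)%N by rewrite absz_gt0 zcontents_eq0.
rewrite ler_pdivlMr ?ltr0n // -natrM ler_nat mulnC -abs_coef_zprimitive.
have [iF|iF] := leqP (size F) i; first by rewrite nth_default.
exact: (@leq_bigmax _ (fun i : 'I_(size F) => `|(F`_i)%R|%N) (Ordinal iF)).
Qed.

Lemma height_le F (B : R) : F != 0 ->
  (forall i, `|((zprimitive F)`_i)%R|%N%:R <= B) -> height R F <= B.
Proof.
move=> F0 hB; rewrite /height gcd_coef_zcontents //.
have c0 : (0 < `|zcontents F|)%N by rewrite absz_gt0 zcontents_eq0.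
have B0 : 0 <= B := le_trans (ler0n _ _) (hB 0%N).
rewrite ler_pdivrMr ?ltr0n //.
apply: (big_ind (fun k : nat => k%:R <= B * `|zcontents F|%N%:R)).
- by rewrite mulr_ge0.
- by move=> x y hx hy; rewrite /maxn; case: ifP.
- by move=> i _; rewrite abs_coef_zprimitive natrM mulrC ler_wpM2r.
Qed.
End NormBounds.

(** In characteristic 0, a non-zero x is a simple root of X^a - x^a: the cofactor takes the value a
    x^(a-1) at x. *)
Lemma mup_comp_polyXn (K : numFieldType) (p : {poly K}) (x : K) a :
  p != 0 -> x != 0 -> (0 < a)%N -> mup x (p \Po 'X^a) = mup (x ^+ a) p.
Proof.
move=> p0 x0 a0; set y := x ^+ a.
have [m [r]] := multiplicity_XsubC p y; rewrite p0 => /= ry ep.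
have Er : p \Po 'X^a = (r \Po 'X^a) * ('X^a - y%:P) ^+ m.
  by rewrite ep comp_polyM rmorphXn /= comp_polyB comp_polyX comp_polyC.
have rx : ~~ root (r \Po 'X^a) x by rewrite /root horner_comp hornerXn.
rewrite Er ep !mupMr // mup_XsubCX eqxx.
have -> : 'X^a - y%:P = ('X - x%:P) * \sum_(i < a) 'X^(a.-1 - i) * x%:P ^+ i :> {poly K}.
  by rewrite /y polyC_exp subrXX.
rewrite exprMn mupMl ?mup_XsubCX ?eqxx // rootE horner_exp expf_eq0 negb_and.
apply/orP; right; rewrite horner_sum.
rewrite (eq_bigr (fun _ => x ^+ a.-1)) => [|i _]; last first.
  rewrite hornerM hornerXn horner_exp hornerC -exprD subnK //.
  by rewrite -ltnS prednK.
by rewrite sumr_const card_ord mulrn_eq0 negb_or -lt0n a0 expf_neq0.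
Qed.

(** * Asymptotics *)

Lemma leq_double_half_add1 k : (k <= 2 * k./2 + 1)%N.
Proof. lia. Qed.

Lemma half_leq_rest k l : (k <= l + k./2)%N -> (k./2 <= l)%N.
Proof. lia. Qed.

Section Asymptotics.
Variable R : realType.

Lemma powR_nat_ge (s c : R) : 0 < s ->
  exists n0 : nat, forall n, (n0 <= n)%N -> c <= n%:R `^ s.
Proof.
move=> s0; exists (Num.truncn (Num.max 0 c `^ s^-1)).+1 => n hn.
apply: (@le_trans _ _ (Num.max 0 c)); first by rewrite le_max lexx orbT.
have m0 : 0 <= Num.max 0 c by rewrite le_max lexx.
rewrite -[leLHS](powRr1 m0) -[X in _ `^ X <= _](mulVf (lt0r_neq0 s0)) powRrM.
apply: ge0_ler_powR; rewrite ?nnegrE ?powR_ge0 //; first exact: ltW.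
by apply: le_trans (ltW (truncnS_gt _)) _; rewrite ler_nat.
Qed.

Lemma ln2_ge_half : 2^-1 <= ln 2 :> R.
Proof.
have := @le_ln1Dx R (- 2^-1); rewrite (_ : 1 + - 2^-1 = 2^-1); last by lra.
by rewrite lnV ?posrE // => h; have := h ltac:(lra); lra.
Qed.

Lemma trunc_log_le_powR (eps : R) : 0 < eps ->
  exists n0 : nat, forall n, (n0 <= n)%N -> (trunc_log 2 n).+2%:R <= n%:R `^ eps.
Proof.
move=> e0; pose s := eps / 2; have s0 : 0 < s by rewrite divr_gt0.
(* With w = n^s, the logarithm to base 2 is at most 2 ln n, hence at most 2w/s. Adding 2 gives at
   most (2 + 2/s) w, which is at most w^2 = n^eps. *)
have [n0 hn0] := powR_nat_ge (2 + 2 / s) s0.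
exists (maxn n0 1) => n; rewrite geq_max => /andP[/hn0 hn n1].
set w := n%:R `^ s in hn.
have si0 : 0 < s^-1 by rewrite invr_gt0.
have w0 : 0 < w by lra.
have -> : n%:R `^ eps = w * w.
  by rewrite -powRD ?pnatr_eq0 -?lt0n ?n1 ?implybT //; congr powR; rewrite /s; lra.
have lnw : ln n%:R <= w / s.
  have -> : ln n%:R = ln w / s :> R by rewrite ln_powR mulrAC divff ?mul1r ?gt_eqF.
  rewrite ler_pM2r //; have := @le_ln1Dx R (w - 1) ltac:(lra).
  by rewrite addrC subrK; lra.
have tl : (trunc_log 2 n)%:R * ln 2 <= ln n%:R :> R.
  rewrite mulr_natl -lnXn // -natrX ler_ln ?posrE ?ltr0n ?expn_gt0 // ler_nat.
  exact: trunc_logP.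
have h2 := ln2_ge_half.
have t0 : 0 <= (trunc_log 2 n)%:R :> R by [].
have -> : (trunc_log 2 n).+2%:R = (trunc_log 2 n)%:R + 2 :> R.
  by rewrite -addn2 natrD.
have : (trunc_log 2 n)%:R <= 2 * (w / s) by nra.
have : (2 + 2 / s) * w <= w * w by rewrite ler_wpM2r // ltW.
have -> : (2 + 2 / s) * w = 2 * w + 2 * (w / s) by lra.
lra.
Qed.

(** L will be the thinning parameter, u absorbs logarithms and constants, and v bounds from below
    both half the number of primes and that half minus L. *)
Lemma prime_supply (mu eps : R) : 0 < eps -> 4 * eps <= mu -> mu < 1 ->
  exists n0 : nat, forall n, (n0 <= n)%N ->
  let L := (trunc_log 2 n).+2 in
  let u := n%:R `^ eps in
  let v := n%:R `^ (mu - 2 * eps) in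
  [/\ L%:R <= u, 16 <= u, 2 <= n%:R `^ mu &
      v <= ((size (primes_upto (Num.truncn (n%:R `^ mu : R))))./2 - L)%:R].
Proof.
move=> e0 emu mu1.
have [n0 hn0] := trunc_log_le_powR e0.
have [n1 hn1] := powR_nat_ge 16 e0.
exists (maxn (maxn n0 n1) 1) => n; rewrite !geq_max => /andP[/andP[/hn0 hL /hn1 hu] npos].
move=> L u v.
have n1' : 1 <= n%:R :> R by rewrite ler1n.
have nD a b : n%:R `^ (a + b) = n%:R `^ a * n%:R `^ b :> R.
  by rewrite powRD // pnatr_eq0 -lt0n npos implybT.
have umu : u * u * v = n%:R `^ mu by rewrite -!nD; congr powR; lra.
have uv : u * u <= v by rewrite -nD; apply: ler_powR => //; lra.
have {}hu : 16 <= u := hu.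
have {}hL : L%:R <= u := hL.
clearbody u v.
have uu : 256 <= u * u by nra.
have v256 : 256 <= v by lra.
split=> //; first by rewrite -umu; nra.
set N := Num.truncn _; set s := size _.
have N1 : n%:R `^ mu < N%:R + 1 by rewrite natr1; exact: truncnS_gt.
have Nn : (N <= n)%N.
  rewrite -(ler_nat R); apply: (@le_trans _ _ (n%:R `^ mu)); first by rewrite truncn_le powR_ge0.
  by rewrite ler1_powR // ltW.
have hs : (N./2 <= L * s)%N.
  apply: leq_trans (chebyshev N) _; rewrite leq_mul2r; apply/orP; right.
  by rewrite ltnS ltnW // ltnS leq_trunc_log.
have hs' : N%:R <= 2 * (L%:R * s%:R) + 1 :> R.
  rewrite -natrM -natrM natr1 ler_nat -addn1.
  by apply: leq_trans (leq_double_half_add1 N) _; rewrite leq_add2r leq_mul2l.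
have s1 : s%:R <= 2 * (s./2)%:R + 1 :> R.
  by rewrite -natrM natr1 ler_nat -addn1 leq_double_half_add1.
have uvs : u * v <= 2 * s%:R + 2.
  have s0 : 0 <= s%:R :> R by [].
  have : u * (u * v) <= u * (2 * s%:R + 2) by nra.
  by rewrite ler_pM2l //; lra.
(* From uv <= 2s + 2 and u >= 16, the half of s is at least 4v - 1, while L <= u <= v. *)
apply: (@le_trans _ _ (s./2%:R - L%:R)).
  have : 16 * v <= u * v by rewrite ler_wpM2r //; lra.
  have : u <= v by nra.
  lra.
have [Ls|Ls] := leqP L s./2; first by rewrite natrB.
apply: le_trans (ler0n _ _).
by rewrite subr_le0 ler_nat ltnW.
Qed.
End Asymptotics.

(** * Degree and height of a common divisor *)

Lemma zprim_zprimitive (F : {poly int}) : F != 0 -> zprim (zprimitive F).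
Proof. by move=> F0; rewrite /zprim zcontents_primitive F0. Qed.

Lemma perm_rts_zprimitive (R : realType) (F : {poly int}) : F != 0 ->
  perm_eq (rts R F) (rts R (zprimitive F)).
Proof.
move=> F0; apply: (@perm_rts _ _ ((zcontents F)%:~R * (lead_coef (zprimitive F))%:~R)) => //.
by rewrite -scalerA -rtsE [in LHS](zpolyEprim F) /toC map_polyZ.
Qed.

Lemma comp_polyXn_neq0 (P : {poly int}) a : (0 < a)%N -> P != 0 -> P \Po 'X^a != 0.
Proof.
by move=> a0 P0; rewrite comp_poly_eq0 // size_polyXn ltnS.
Qed.

(** [weighted_thinning] is applied twice: with weight 1 for the degree, and with the root height,
    multiplied by a >= T along an edge, for the Mahler measure. Primitive parts have the same roots
    and make the heights sum to [logM]. *)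
Lemma common_divisor_bounds (R : realType) (P Q : {poly int}) (B : seq nat) (m T : nat) :
  P != 0 -> Q != 0 -> uniq B -> all prime B -> {in B, forall a, (T <= a)%N} ->
  {in B, forall a, Zdvdp Q (P \Po 'X^a)} ->
  {in rts R Q, forall x, nontorsion x} -> ((size Q).-1 < 2 ^ m)%N ->
  (size B - m)%:R * (size Q).-1%:R <= m%:R * (size P).-1%:R :> R /\
  (size B - m)%:R * T%:R * logM R (zprimitive Q) <= m%:R * logM R (zprimitive P).
Proof.
move=> P0 Q0 uB pB TB dvdB nt Qm.
have szm : (size (undup (rts R Q)) < 2 ^ m)%N.
  by apply: leq_ltn_trans (size_undup _) _; rewrite size_rts.
have cnt : {in rts R Q & B, forall x a,
    (count_mem x (rts R Q) <= count_mem (x ^+ a) (rts R P))%N}.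
  move=> x a xQ aB; have [x0 _] := nt _ xQ.
  have a0 : (0 < a)%N by rewrite prime_gt0 // (allP pB).
  have [G eG] := dvdB _ aB.
  have G0 : G != 0.
    by apply: contraNneq (comp_polyXn_neq0 a0 P0) => G0; rewrite eG G0 mulr0.
  rewrite !count_rts // -mup_comp_polyXn ?toC_eq0 //.
  have -> : toC R P \Po 'X^a = toC R (P \Po 'X^a).
    by rewrite /toC map_comp_poly map_polyXn.
  by rewrite eG toCM mupM ?toC_eq0 // leq_addr.
split.
  have w1 : {in rts R Q & B, forall x a, 1 * 1 <= 1 :> R}.
    by move=> ? ? _ _; rewrite mulr1.
  have := weighted_thinning (w := fun=> 1) uB pB szm nt (fun=> ler01) ler01 cnt w1.
  by rewrite !big_const_seq !count_predT !iter_addr !addr0 !size_rts // mulr1.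
rewrite !logM_sum ?zprim_zprimitive //.
rewrite -!(perm_big _ (perm_rts_zprimitive R _)) //.
apply: weighted_thinning => //; first exact: root_height_ge0.
move=> x a xQ aB; have a0 : (0 < a)%N by rewrite prime_gt0 // (allP pB).
rewrite -(prednK a0) (@root_heightX R x a.-1 Q Q0) -?mem_rts // prednK //.
by rewrite ler_wpM2r ?root_height_ge0 // ler_nat TB.
Qed.

(** The factor (n+1)^deg from [mahler_le_coef] is at most exp(nL), because n + 1 <= 2^L <= e^L. *)
Lemma logM_zprimitive_le (R : realType) (P : {poly int}) n L (b : R) : P != 0 ->
  ((size P).-1 <= n)%N -> (n < 2 ^ L)%N -> height R P <= expR b ->
  logM R (zprimitive P) <= n%:R * L%:R + b.
Proof.
move=> P0 Pn nL hP; rewrite -ler_expR.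
have P'0 : zprimitive P != 0 by rewrite zprimitive_eq0.
have sP : (size (zprimitive P) <= n.+1)%N.
  by rewrite size_zprimitive; lia.
apply: (@le_trans _ _ (n.+1%:R ^+ (size (zprimitive P)).-1 * expR b)).
  apply: mahler_le_coef => // i.
  exact: le_trans (coef_zprimitive_le_height R i P0) hP.
rewrite expRD ler_wpM2r ?expR_ge0 // expRM_natl.
have e1 : n.+1%:R <= expR L%:R :> R.
  apply: (@le_trans _ _ (2 ^+ L)); first by rewrite -natrX ler_nat.
  rewrite -[L%:R]mulr1 expRM_natl lerXn2r ?nnegrE ?expR_ge0 //.
  by have := @expR_ge1Dx R 1.
apply: (@le_trans _ _ (expR L%:R ^+ (size (zprimitive P)).-1)).
  by rewrite lerXn2r ?nnegrE ?expR_ge0.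
by rewrite ler_weXn2l // ?size_zprimitive // (le_trans _ e1) // ler1n.
Qed.

Lemma height_le_expR (R : realType) (Q : {poly int}) : Q != 0 ->
  height R Q <= expR ((size Q).-1%:R + logM R (zprimitive Q)).
Proof.
move=> Q0; apply: height_le => // i.
apply: le_trans (coef_le_mahler R i _) _; first by rewrite zprimitive_eq0.
rewrite size_zprimitive [leRHS]expRD ler_wpM2r ?expR_ge0 //.
rewrite -[X in expR X]mulr1 expRM_natl lerXn2r ?nnegrE ?expR_ge0 //.
by have := @expR_ge1Dx R 1.
Qed.

Lemma size_primes_above N T :
  (size (primes_upto N) <= size [seq p <- primes_upto N | T <= p] + T)%N.
Proof.
rewrite size_filter -(count_predC (fun p => T <= p)%N) leq_add2l -size_filter.
rewrite -[leqRHS](size_iota 0); apply: uniq_leq_size.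
  by apply: filter_uniq; apply: filter_uniq; exact: iota_uniq.
by move=> p; rewrite mem_filter /= mem_iota -ltnNge => /andP[].
Qed.

Theorem theorem1p2 (R : realType) (beta delta mu : R)
    (delta_gt0 : 0 < delta) (mu_gt0 : 0 < mu) (mu_lt1 : mu < 1)
    (beta_gt : 1 + mu < beta) :
  exists n0 : nat, forall n : nat, (0 < n)%N -> (n0 <= n)%N ->
  forall P Q : {poly int},
    P != 0 ->
    ((size P).-1 <= n)%N ->
    height R P <= expR (n%:R `^ beta) ->
    (forall z : R[i], root (map_poly (intr : int -> R[i]) P) z ->
       z != 0 /\ ~ is_root_of_unity z) ->
    is_Zgcdp [set P \Po 'X^a | a in primes_le (n%:R `^ mu)] Q ->
    (size Q).-1%:R <= n%:R `^ (1 - mu + delta) /\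
    height R Q <= expR (n%:R `^ (beta - 2 * mu + delta)).
Proof.
(* The exponents below lose at most 6 eps, within delta; [prime_supply] asks for 4 eps <= mu. *)
pose eps := Num.min (delta / 8) (mu / 4).
have e0 : 0 < eps by rewrite lt_min !divr_gt0.
have ed : 8 * eps <= delta.
  have : eps <= delta / 8 by rewrite ge_min lexx.
  by lra.
have em : 4 * eps <= mu.
  have : eps <= mu / 4 by rewrite ge_min lexx orbT.
  by lra.
have [n0 hn0] := prime_supply e0 em mu_lt1.
exists n0 => n n_gt0 /hn0 /= [Lu u16 n2 vT] P Q P0 Pn hP rtP [Qdvd _].
move: Lu vT; set L := (trunc_log 2 n).+2; set N := Num.truncn _.
(* Fewer than half of the primes, up to rounding, can lie below T, so discarding those keeps enough
   labels, all of size at least T. *)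
set T := (size _)./2 => Lu vT.
pose B := [seq p <- primes_upto N | (T <= p)%N].
have le_N p : (p <= N)%N -> p%:R <= n%:R `^ mu.
  move=> pN; apply: (@le_trans _ _ N%:R); first by rewrite ler_nat.
  by rewrite truncn_le powR_ge0.
have dvdQ p : prime p -> p%:R <= n%:R `^ mu -> Zdvdp Q (P \Po 'X^p).
  by move=> pp pn; apply: Qdvd; exists p.
have dvd2 := dvdQ 2%N isT n2.
have Q0 : Q != 0.
  have [G eG] := dvd2; apply: contraNneq (@comp_polyXn_neq0 P 2 isT P0) => Q0.
  by rewrite eG Q0 mul0r.
have nL : (n < 2 ^ L)%N.
  apply: leq_trans (trunc_log_ltn n (ltnSn 1)) _.
  by rewrite leq_exp2l.
(* Q divides P(X^2), so its degree is at most 2n, and 2n < 2^L by the choice of L. *)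
have szQ : ((size Q).-1 < 2 ^ L)%N.
  have [G eG] := dvd2.
  have G0 : G != 0.
    by apply: contraNneq (@comp_polyXn_neq0 P 2 isT P0) => G0; rewrite eG G0 mulr0.
  have := size_comp_poly P 'X^2; rewrite eG size_mul // size_polyXn /=.
  have := trunc_log_ltn n (ltnSn 1); rewrite -(ltn_pmul2l (ltn0Sn 1)) -expnS.
  rewrite -/L; have : (0 < size G)%N by rewrite size_poly_gt0.
  by move: Pn; clear; move: (2 ^ L)%N (size P) (size Q) (size G) => K a b c; lia.
have ntQ : {in rts R Q, forall x, nontorsion x}.
  move=> x; rewrite mem_rts // => Qx.
  have [] := rtP (x ^+ 2).
    have [G eG] := dvd2.
    have : root (toC R (P \Po 'X^2)) x by rewrite eG toCM rootM Qx.
    by rewrite /toC map_comp_poly map_polyXn /root horner_comp hornerXn.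
  rewrite expf_eq0 => /= x0 xt; split=> // k k0; apply/eqP => xk; apply: xt.
  by exists k => //; rewrite exprAC xk expr1n.
have uB : uniq B by apply: filter_uniq; apply: filter_uniq; exact: iota_uniq.
have BP p : p \in B -> [/\ prime p, (p <= N)%N & (T <= p)%N].
  by rewrite mem_filter mem_primes_upto => /and3P[-> -> ->].
have pB : all prime B by apply/allP => p /BP[].
have [|p /BP[pp pN _]|hD hM] :=
    @common_divisor_bounds R P Q B L T P0 Q0 uB pB _ _ ntQ szQ.
- by move=> p /BP[].
- exact: dvdQ (le_N _ pN).
set D := (size Q).-1%:R in hD *; set lQ := logM R (zprimitive Q) in hM.
set lP := logM R (zprimitive P) in hM.
have n1 : 1 <= n%:R :> R by rewrite ler1n.
have nD a b : n%:R `^ (a + b) = n%:R `^ a * n%:R `^ b :> R.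
  by rewrite powRD // pnatr_eq0 -lt0n n_gt0 implybT.
have nle a b : a <= b -> n%:R `^ a <= n%:R `^ b :> R by exact: ler_powR.
set u := n%:R `^ eps in Lu u16 *; set v := n%:R `^ (mu - 2 * eps) in vT.
have v0 : 0 < v by rewrite powR_gt0 // ltr0n.
have vB : v <= (size B - L)%:R.
  apply: le_trans vT _; rewrite ler_nat leq_sub2r //.
  exact/half_leq_rest/size_primes_above.
have vT' : v <= T%:R by apply: le_trans vT _; rewrite ler_nat leq_subr.
have D0 : 0 <= D by [].
have lQ0 : 0 <= lQ := logM_ge0 R _.
have lP0 : 0 <= lP := logM_ge0 R _.
(* v D <= L deg P <= u n. *)
have deg_le : D <= n%:R `^ (1 - mu + 3 * eps).
  rewrite -(ler_pM2l v0).
  have -> : v * n%:R `^ (1 - mu + 3 * eps) = u * n%:R.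
    by rewrite -[X in _ = _ * X](powRr1 (ler0n R n)) -!nD; congr powR; lra.
  apply: (@le_trans _ _ ((size B - L)%:R * D)); first by rewrite ler_wpM2r.
  apply: le_trans hD _; apply: ler_pM => //.
  by rewrite ler_nat.
have lP_le : lP <= 2 * n%:R `^ beta.
  have := logM_zprimitive_le P0 Pn nL hP; rewrite -/lP.
  have : n%:R * L%:R <= n%:R `^ beta.
    apply: (@le_trans _ _ (n%:R * u)); first by rewrite ler_wpM2l.
    rewrite -[X in X * _](powRr1 (ler0n R n)) -nD; apply: nle; lra.
  lra.
(* One factor v comes from the number of primes, the other from their size. *)
have lQ_le : lQ <= 2 * n%:R `^ (beta - 2 * mu + 5 * eps).
  have vv0 : 0 < v * v by rewrite mulr_gt0.
  rewrite -(ler_pM2l vv0).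
  have -> : v * v * (2 * n%:R `^ (beta - 2 * mu + 5 * eps)) = u * (2 * n%:R `^ beta).
    by rewrite mulrCA [RHS]mulrCA -!nD; congr (_ * powR _ _); lra.
  apply: (@le_trans _ _ ((size B - L)%:R * T%:R * lQ)).
    by rewrite ler_wpM2r // ler_pM // ltW.
  apply: le_trans hM _; exact: ler_pM.
split.
  by apply: le_trans deg_le _; apply: nle; lra.
apply: le_trans (height_le_expR R Q0) _; rewrite ler_expR -/D -/lQ.
set c := n%:R `^ (beta - 2 * mu + 5 * eps) in lQ_le.
have c0 : 0 <= c by exact: powR_ge0.
(* Here beta > 1 + mu makes the degree term no larger than c. The sum is then at most 3c, hence at
   most cu. *)
have Dc : D <= c by apply: le_trans deg_le _; apply: nle; lra.
apply: (@le_trans _ _ (c * u)); first by nra.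
by rewrite -nD; apply: nle; lra.
Qed.
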